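(* Let $p$ be a prime with $p\equiv 7 \pmod{24}$. Then $$r_p(\mathbb{F}_p^3)\geq(p-1)^3+(p-1)=p^3-3p^2+4p-2.$$ Moreover, $r_7(\mathbb{F}_7^3)\geq 225$.
   Context: For a prime $p$, an integer $k$ with $3\le k\le p$ and $n\in\mathbb{N}$, a $k$-progression in $\mathbb{F}_p^n$ is a set of $k$ points of the form $\{a+ib : i\in\{0,1,\dots,k-1\}\}$ with $a,b\in\mathbb{F}_p^n$, $b\neq 0$. $r_k(\mathbb{F}_p^n)$ denotes the maximum cardinality of a subset of $\mathbb{F}_p^n$ containing no $k$-progression. For $k=p$ these progressions are exactly the affine lines of $\mathbb{F}_p^n$. *)

(* Defs.v *)
From mathcomp Require Import all_boot all_algebra.
Set Implicit Arguments.
Unset Strict Implicit.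
Unset Printing Implicit Defensive.
Import GRing.Theory.
Local Open Scope ring_scope.

(* The points [a + i b] are pairwise distinct, so that [S] has exactly [k]
   elements, when [p] is prime and [k <= p]. *)
Definition is_progression (p n k : nat) (S : {set 'rV['F_p]_n}) : bool :=
  [exists a : 'rV['F_p]_n, exists b : 'rV['F_p]_n,
     (b != 0) && (S == [set a + (i : nat)%:R *: b | i : 'I_k])].

Definition progression_free (p n k : nat) (A : {set 'rV['F_p]_n}) : bool :=
  [forall S : {set 'rV['F_p]_n}, is_progression k S ==> ~~ (S \subset A)].

(* [r k p n] is r_k(F_p^n). *)
Definition r (k p n : nat) : nat :=
  \max_(A : {set 'rV['F_p]_n} | progression_free k A) #|A|.

(* Main.v *)
Require Import Defs.
From mathcomp Require Import all_boot all_algebra.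
From mathcomp Require Import all_field.
From mathcomp Require Import ring zify.

(* A line-free set is the complement of a set meeting every line.  The points
   with a zero coordinate meet every line, and leave [(p - 1) ^ 3] points.  Add
   back the [p - 1] floor points [(l, height l, 0)], [l <> 0], where [height l]
   is a quadratic residue.  A line through such a point still meets both planes
   [x = 0] and [y = 0], unless it is parallel to one of them; only the vertical
   line becomes unblocked.  To repair it, the blocking point [(l, 0, rho l)] is
   moved to [(l, height l, rho l)], which in turn frees the line from the floor
   point to [(l, 0, rho l)]; that line is blocked again by moving
   [(0, (1 + e) * height l, - e * rho l)] parallel to the x-axis onto it.  The
   points of the first kind lie at residue levels, those of the second kind at
   non-residue levels, so horizontal lines remain blocked.  If [e] is a residue
   and [1 + e] is not, a line parallel to the plane [y = 0] is not affected, and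
   the remaining lines through floor points could only lose both their side
   points if [(1 + e) / e] were one of [1, -1, 4, -4, 1/4, -1/4].
   As [-1] and [3] are non-residues, one of [e = 1] and [e = 2] qualifies as
   soon as [p > 7]. *)

Set Implicit Arguments.
Unset Strict Implicit.
Unset Printing Implicit Defensive.

Import GRing.Theory.

(** * Normal forms of lines in three-dimensional space *)

Section LinesInSpace.
Variable F : fieldType.
Local Open Scope ring_scope.

(** Scaling the direction makes its last nonzero coordinate 1; sliding the base point then makes
    that coordinate the parameter itself. *)
Lemma blocks_linesP (B : F -> F -> F -> Prop) :
  (forall x y u v, exists s, B (x + s * u) (y + s * v) s) ->
  (forall x z u, exists s, B (x + s * u) s z) ->
  (forall y z, exists s, B s y z) ->
  forall x y z u v w, (u, v, w) != (0, 0, 0) ->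
    exists s, B (x + s * u) (y + s * v) (z + s * w).
Proof.
move=> blockZ blockY blockX x y z u v w; rewrite !xpair_eqE.
have [-> | w0] := eqVneq w 0; last first.
  move=> _; have [s] := blockZ (x - z / w * u) (y - z / w * v) (u / w) (v / w).
  by move=> Bs; exists ((s - z) / w); congr (B _ _ _): Bs; field.
have [-> | v0] := eqVneq v 0; last first.
  move=> _; have [s] := blockY (x - y / v * u) z (u / v).
  by move=> Bs; exists ((s - y) / v); congr (B _ _ _): Bs; field.
rewrite !andbT => u0; have [s] := blockX y z.
by move=> Bs; exists ((s - x) / u); congr (B _ _ _): Bs; field.
Qed.

End LinesInSpace.

(** * Quadratic residues and cube roots of unity in finite fields *)

Section QuadraticCharacter.
Variable F : finFieldType.
Local Open Scope ring_scope.

(* Euler's criterion, taken as the definition. *)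
Definition qres (x : F) : bool := x ^+ (#|F|.-1./2) == 1.

Lemma expf_pred_card (x : F) : x != 0 -> x ^+ #|F|.-1 = 1.
Proof.
move=> x0; apply: (mulfI x0); rewrite -exprS mulr1 prednK ?expf_card //.
by apply/card_gt0P; exists x.
Qed.

Hypothesis oddF : odd #|F|.

Lemma double_half_pred_card : (#|F|.-1./2).*2 = #|F|.-1.
Proof.
by rewrite even_halfK //; case: #|F| oddF => //= n.
Qed.

Lemma qres_sqr (x : F) : x != 0 -> qres (x ^+ 2).
Proof.
by move=> x0; rewrite /qres -exprM mul2n double_half_pred_card expf_pred_card.
Qed.

Lemma expf_half_card (x : F) : x != 0 ->
  x ^+ (#|F|.-1./2) = if qres x then 1 else -1.
Proof.
move=> x0; rewrite /qres; case: eqVneq => // ne1.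
have /eqP : (x ^+ #|F|.-1./2) ^+ 2 = 1.
  by rewrite -exprM muln2 double_half_pred_card expf_pred_card.
by rewrite sqrf_eq1 (negPf ne1) /= => /eqP.
Qed.

(** Otherwise the characteristic is 2 and the order of the field, a positive power of 2, is even. *)
Lemma oppr1_neq1 : (-1 : F) != 1.
Proof.
apply/eqP => e; move: oddF; have pchar2 : 2 \in [pchar F].
  by rewrite inE /= mulr2n -(addNr (1 : F)) e eqxx.
have := finNzRing_gt1 F; rewrite (card_pprimeChar pchar2).
by case: logn => // n _; rewrite oddX.
Qed.

Lemma qresM (x y : F) : x != 0 -> y != 0 -> qres (x * y) = (qres x == qres y).
Proof.
move=> x0 y0; rewrite {1}/qres exprMn !expf_half_card //.
by case: (qres x); case: (qres y);
  rewrite ?mulrNN ?mulr1 ?mul1r ?eqxx ?(negPf oppr1_neq1).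
Qed.

Lemma qres1 : qres 1.
Proof. by rewrite /qres expr1n. Qed.

Lemma qresN1 : odd (#|F|.-1./2) -> ~~ qres (-1).
Proof. by move=> odd_half; rewrite /qres -signr_odd odd_half oppr1_neq1. Qed.

(** Write [#|F|.-1] as [m * 3]. As [X^m - 1] has at most [m] roots, some nonzero [x] has
    [x ^+ m != 1]; this power is a root of [X^3 - 1] other than 1. *)
Lemma exists_cube_root_unity : (3 %| #|F|.-1)%N ->
  exists2 w : F, w != 0 & w ^+ 2 + w + 1 = 0.
Proof.
move=> /dvdnP [m card_m].
have m0 : (0 < m)%N.
  by case: m card_m => //; have := finNzRing_gt1 F; case: #|F| => [|[]].
have [/existsP [x /andP [x0 xm]] | ] :=
  boolP [exists x : F, (x != 0) && (x ^+ m != 1)].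
  exists (x ^+ m); first by rewrite expf_neq0.
  have : (x ^+ m - 1) * ((x ^+ m) ^+ 2 + x ^+ m + 1) = 0.
    transitivity ((x ^+ m) ^+ 3 - 1); first by ring.
    by rewrite -exprM -card_m expf_pred_card // subrr.
  by move/eqP; rewrite mulf_eq0 subr_eq0 (negPf xm) /= => /eqP.
rewrite negb_exists => /forallP allm.
pose rs := enum [pred x : F | x != 0].
have size_rs : size rs = #|F|.-1 by rewrite -cardE cardC1.
have := @max_poly_roots F ('X^m - 1%:P) rs.
rewrite -size_poly_eq0 size_XnsubC // size_rs card_m enum_uniq.
have -> : all (root ('X^m - 1%:P)) rs.
  apply/allP => x; rewrite mem_enum inE => x0.
  have := allm x; rewrite x0 /= negbK => /eqP xm.
  by rewrite /root !hornerE xm subrr.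
by move=> /(_ isT isT isT); lia.
Qed.

(** If [w] is a primitive cube root of unity, [2 * w + 1] is a square root of -3. *)
Lemma qresN3 : 3%:R != 0 :> F -> (3 %| #|F|.-1)%N -> qres (- 3%:R).
Proof.
move=> three0 /exists_cube_root_unity [w w0 ew].
have e : (2%:R * w + 1) ^+ 2 = - 3%:R.
  have -> : (2%:R * w + 1) ^+ 2 = 4%:R * (w ^+ 2 + w + 1) - 3%:R by ring.
  by rewrite ew mulr0 sub0r.
rewrite -e qres_sqr //; apply: contraNneq three0 => e0.
by move: e; rewrite e0 expr0n /= => /eqP; rewrite eq_sym oppr_eq0.
Qed.

End QuadraticCharacter.

(** * The construction, depending on a parameter [e] *)

Section Construction.
Variables (F : finFieldType) (e : F).
Local Open Scope ring_scope.

Let nonzero : {set F} := [set x | x != 0].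

(* [rho l] and [height l] are always quadratic residues when [-1] is not one. *)
Definition rho (l : F) : F := if qres l then l else - l.
Definition height (l : F) : F := if qres l then l else - 4%:R * l.

Definition generic_points : {set F * F * F} := setX (setX nonzero nonzero) nonzero.
Definition new_floor : {set F * F * F} :=
  [set (l, height l, 0) | l in nonzero].
Definition new_sideY : {set F * F * F} :=
  [set (l, 0, rho l) | l in nonzero].
Definition new_sideX : {set F * F * F} :=
  [set (0, (1 + e) * height l, - e * rho l) | l in nonzero].
Definition lostY : {set F * F * F} :=
  [set (l, height l, rho l) | l in nonzero].
Definition lostX : {set F * F * F} :=
  [set (l, (1 + e) * height l, - e * rho l) | l in nonzero].

Definition line_free_set : {set F * F * F} :=
  generic_points :\: (lostY :|: lostX)
    :|: (new_floor :|: (new_sideY :|: new_sideX)).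

Hypothesis oddF : odd #|F|.
Hypothesis qresFN1 : ~~ qres (-1 : F).
Hypotheses (e_neq0 : e != 0) (qres_e : qres e).
Hypotheses (e1_neq0 : 1 + e != 0) (qres_e1 : ~~ qres (1 + e)).

Lemma four_neq0 : 4%:R != 0 :> F.
Proof.
have -> : 4%:R = (1 + 1) ^+ 2 :> F by ring.
rewrite expf_eq0 /= addr_eq0 eq_sym; exact: oppr1_neq1.
Qed.

Lemma qresN x : x != 0 -> qres (- x : F) = ~~ qres x.
Proof.
move=> x0; rewrite -mulN1r qresM ?oppr_eq0 ?oner_eq0 // (negPf qresFN1).
by case: qres.
Qed.

Lemma qres4 : qres (4%:R : F).
Proof.
have e4 : 4%:R = (1 + 1) ^+ 2 :> F by ring.
by rewrite e4 qres_sqr //; have := four_neq0; rewrite e4 expf_eq0.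
Qed.

Lemma rho_neq0 l : l != 0 -> rho l != 0.
Proof. by rewrite /rho; case: ifP; rewrite ?oppr_eq0. Qed.

Lemma height_neq0 l : l != 0 -> height l != 0.
Proof.
by rewrite /height; case: ifP => // _ l0; rewrite mulf_neq0 // oppr_eq0 four_neq0.
Qed.

Lemma qres_rho l : l != 0 -> qres (rho l).
Proof. by rewrite /rho; case: ifP => // q l0; rewrite qresN // q. Qed.

Lemma qres_height l : l != 0 -> qres (height l).
Proof.
rewrite /height; case: ifP => // q l0.
by rewrite mulNr qresN ?mulf_neq0 ?four_neq0 // qresM ?four_neq0 // qres4 q.
Qed.

Lemma qres_sideX_height l : l != 0 -> ~~ qres ((1 + e) * height l).
Proof.
by move=> l0; rewrite qresM ?height_neq0 // qres_height // (negPf qres_e1).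
Qed.

Lemma qres_sideX_depth l : l != 0 -> ~~ qres (- e * rho l).
Proof.
by move=> l0; rewrite mulNr qresN ?mulf_neq0 ?rho_neq0 // qresM ?rho_neq0 //
  qres_e qres_rho.
Qed.

(** If only one of [l], [m] is a residue, then [l = - m] and one height is 4 times the other, which
    forces 3 to vanish. With 1 in place of the 4 in [height], [l] and [- l] would share both
    values. *)
Lemma rho_height_inj l m : l != 0 -> m != 0 -> 3%:R != 0 :> F ->
  rho l = rho m -> height l = height m -> l = m.
Proof.
move=> l0 m0 three0; rewrite /rho /height; case: ifP => _; case: ifP => _ //.
- move=> -> /eqP; rewrite -subr_eq0 => /eqP em.
  have /eqP : 3%:R * m = 0 by rewrite -em; ring.
  by rewrite mulf_eq0 (negPf three0) (negPf m0).
- move=> <- /eqP; rewrite -subr_eq0 => /eqP el.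
  have /eqP : 3%:R * l = 0 by rewrite -[RHS]oppr0 -el; ring.
  by rewrite mulf_eq0 (negPf three0) (negPf l0).
by move/oppr_inj.
Qed.

(** * Counting the points of the set *)

Lemma cardsU_disjoint (T : finType) (A B : {set T}) :
  [disjoint A & B] -> #|A :|: B| = (#|A| + #|B|)%N.
Proof. by move=> dAB; apply/eqP; rewrite (leq_card_setU A B). Qed.

Lemma card_nonzero : #|nonzero| = #|F|.-1.
Proof. by rewrite cardsE cardC1. Qed.

(** At most [2 * #|F|.-1] generic points are removed, and [3 * #|F|.-1] points of the coordinate
    planes are added. *)
Lemma card_line_free_set : 3%:R != 0 :> F ->
  (#|F|.-1 ^ 3 + #|F|.-1 <= #|line_free_set|)%N.
Proof.
move=> three0.
have card_floor : #|new_floor| = #|F|.-1.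
  by rewrite card_imset ?card_nonzero // => l m [].
have card_sideY : #|new_sideY| = #|F|.-1.
  by rewrite card_imset ?card_nonzero // => l m [].
have card_sideX : #|new_sideX| = #|F|.-1.
  rewrite card_in_imset ?card_nonzero // => l m; rewrite !inE => l0 m0 [].
  move=> /(mulfI e1_neq0) eh; rewrite !mulNr => /oppr_inj /(mulfI e_neq0) er.
  exact: rho_height_inj er eh.
have card_lostY : (#|lostY| <= #|F|.-1)%N.
  by rewrite -card_nonzero leq_imset_card.
have card_lostX : (#|lostX| <= #|F|.-1)%N.
  by rewrite -card_nonzero leq_imset_card.
have card_generic : #|generic_points| = (#|F|.-1 ^ 3)%N.
  by rewrite !cardsX card_nonzero !expnS expn0 muln1 mulnA.
have card_kept :
    (#|F|.-1 ^ 3 <= #|generic_points :\: (lostY :|: lostX)| + #|F|.-1 + #|F|.-1)%N.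
  have := cardsID (lostY :|: lostX) generic_points; rewrite card_generic => <-.
  rewrite addnC -addnA leq_add2l.
  apply: leq_trans (leq_add card_lostY card_lostX).
  exact: leq_trans (subset_leq_card (subsetIr _ _)) (leq_card_setU _ _).
have disj_sides : [disjoint new_sideY & new_sideX].
  rewrite -setI_eq0; apply/eqP/setP => -[[x y] z]; rewrite inE in_set0.
  apply/negP => /andP [/imsetP [l]]; rewrite inE => l0 [-> _ _].
  by case/imsetP => m _ [] /eqP; rewrite (negPf l0).
have disj_floor : [disjoint new_floor & new_sideY :|: new_sideX].
  rewrite -setI_eq0; apply/eqP/setP => -[[x y] z]; rewrite !inE.
  apply/negP => /andP [/imsetP [l]]; rewrite inE => l0 [-> _ ->].
  case/orP => /imsetP [m]; rewrite inE => m0 [ex _ ez].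
    by have := rho_neq0 m0; rewrite -ez eqxx.
  by rewrite ex eqxx in l0.
have disj_generic : [disjoint generic_points :\: (lostY :|: lostX)
                     & new_floor :|: (new_sideY :|: new_sideX)].
  rewrite -setI_eq0; apply/eqP/setP => -[[x y] z]; rewrite !inE /=.
  apply/negP => /andP [/andP [_ /andP [/andP [x0 y0] z0]]].
  case/or3P => /imsetP [m _ [ex ey ez]].
  - by rewrite ez eqxx in z0.
  - by rewrite ey eqxx in y0.
  by rewrite ex eqxx in x0.
rewrite !cardsU_disjoint // card_floor card_sideY card_sideX.
by move: card_kept; lia.
Qed.

(** * Membership in the set, and the blocking of every line *)

Lemma notin_line_free_set_lost x y z :
  (x, y, z) \in lostY :|: lostX -> (x, y, z) \notin line_free_set.
Proof.
move=> lost; rewrite 2!inE lost /= => {}; rewrite !inE !negb_or.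
(* A lost point has no zero coordinate, whereas every added point has one. *)
have [x0 y0 z0] : [/\ x != 0, y != 0 & z != 0].
  case/setUP: lost => /imsetP [l]; rewrite inE => l0 [-> -> ->].
    by rewrite rho_neq0 ?height_neq0.
  by rewrite !mulf_neq0 ?oppr_eq0 ?rho_neq0 ?height_neq0.
apply/and3P; split; apply/imsetP => -[m _ [ex ey ez]].
- by rewrite ez eqxx in z0.
- by rewrite ey eqxx in y0.
by rewrite ex eqxx in x0.
Qed.

Lemma line_free_set_sideX y z :
  z != 0 -> (0, y, z) \in line_free_set ->
  exists2 l, l != 0 & y = (1 + e) * height l /\ z = - e * rho l.
Proof.
move=> z0; rewrite !inE eqxx !andbF /=.
case/or3P => /imsetP [m]; rewrite inE => m0.
- by case=> _ _ ez; rewrite ez eqxx in z0.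
- by case=> ex; rewrite -ex eqxx in m0.
by case=> ey ez; exists m.
Qed.

Lemma line_free_set_sideY x z :
  z != 0 -> (x, 0, z) \in line_free_set -> x != 0 /\ z = rho x.
Proof.
move=> z0; rewrite !inE eqxx !andbF /=.
case/or3P => /imsetP [m]; rewrite inE => m0.
- by case=> _ _ ez; rewrite ez eqxx in z0.
- by case=> -> ->.
by case=> _ ey; have := mulf_neq0 e1_neq0 (height_neq0 m0); rewrite -ey eqxx.
Qed.

Lemma line_free_set_floor x y :
  (x, y, 0) \in line_free_set -> x != 0 /\ y = height x.
Proof.
rewrite !inE eqxx !andbF /=.
case/or3P => /imsetP [m]; rewrite inE => m0.
- by case=> -> ->.
- by case=> _ _ ez; have := rho_neq0 m0; rewrite -ez eqxx.
case=> _ _ ez; have := mulf_neq0 e_neq0 (rho_neq0 m0).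
by rewrite -oppr_eq0 -mulNr -ez eqxx.
Qed.

Lemma notin_line_free_set_lostY l :
  l != 0 -> (l, height l, rho l) \notin line_free_set.
Proof.
move=> l0; apply/notin_line_free_set_lost/setUP; left.
by apply/imsetP; exists l; rewrite ?inE.
Qed.

Lemma notin_line_free_set_lostX l :
  l != 0 -> (l, (1 + e) * height l, - e * rho l) \notin line_free_set.
Proof.
move=> l0; apply/notin_line_free_set_lost/setUP; right.
by apply/imsetP; exists l; rewrite ?inE.
Qed.

Lemma line_free_set_blocks_alongX y z :
  exists s, (s, y, z) \notin line_free_set.
Proof.
have [-> | z0] := eqVneq z 0.
  by exists 0; apply/negP => /line_free_set_floor []; rewrite eqxx.
have [/(line_free_set_sideX z0) [l l0 [-> ->]] | ] :=
  boolP ((0, y, z) \in line_free_set); last by exists 0.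
by exists l; apply: notin_line_free_set_lostX.
Qed.

Lemma line_free_set_blocks_alongY (x z u : F) :
  exists s, (x + s * u, s, z) \notin line_free_set.
Proof.
have [-> | z0] := eqVneq z 0.
  have [-> | u0] := eqVneq u 0.
    (* The floor has at most one point of the set for each [x], so any other height will do. *)
    exists (height x + 1); rewrite mulr0 addr0.
    apply/negP => /line_free_set_floor [_] /eqP.
    by rewrite -subr_eq0 addrAC subrr add0r oner_eq0.
  exists (- x / u); rewrite divfK // addrN.
  by apply/negP => /line_free_set_floor []; rewrite eqxx.
(* Away from the floor, points of the set with [y = 0] lie at residue levels and those with [x = 0]
   at non-residue levels, so one of the two planes blocks the line. A line parallel to the y-axis
   may need a point of [lostY] instead. *)
have [qz | nqz] := boolP (qres z); last first.
  exists 0; rewrite mul0r addr0; apply/negP => /(line_free_set_sideY z0) [x0 ez].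
  by rewrite ez qres_rho in nqz.
have [-> | u0] := eqVneq u 0.
  have [/(line_free_set_sideY z0) [x0 ->] | ] :=
    boolP ((x, 0, z) \in line_free_set).
    by exists (height x); rewrite mulr0 addr0; apply: notin_line_free_set_lostY.
  by exists 0; rewrite mulr0 addr0.
exists (- x / u); rewrite divfK // addrN.
apply/negP => /(line_free_set_sideX z0) [l l0 [_ ez]].
by have := qres_sideX_depth l0; rewrite -ez qz.
Qed.

Lemma rho_signP l : rho l = l \/ rho l = - l.
Proof. by rewrite /rho; case: ifP; [left | right]. Qed.

Lemma height_rhoP l : height l = rho l \/ height l = 4%:R * rho l.
Proof. by rewrite /height /rho; case: ifP; [left | right; ring]. Qed.

Lemma heightP l : height l = l \/ height l = - 4%:R * l.
Proof. by rewrite /height; case: ifP; [left | right]. Qed.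

Hypothesis e_generic :
  [/\ 2%:R * e + 1 != 0, 3%:R * e - 1 != 0, 5%:R * e + 1 != 0,
      3%:R * e + 4%:R != 0 & 5%:R * e + 4%:R != 0].

(** The quotients [height m / rho m], [height l / l] and [n / rho n] are in {1, 4}, {1, -4} and {1,
    -1}. Equality would make [(1 + e) / e] one of 1, -1, 4, -4, 1/4, -1/4; the first is absurd and
    [e_generic] excludes the others, in this order. *)
Lemma height_ratio_neq l m n : l != 0 -> m != 0 -> n != 0 ->
  (1 + e) * height m * rho n * l != e * height l * rho m * n.
Proof.
move=> l0 m0 n0; case: e_generic => g1 g2 g3 g4 g5; rewrite -subr_eq0.
have nz := rho_neq0 m0; have four0 := four_neq0.
have rn : n = rho n \/ n = - rho n.
  by case: (rho_signP n) => ->; [left | right; rewrite opprK].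
suff [c c0 ->] : exists2 c, c != 0 &
    (1 + e) * height m * rho n * l - e * height l * rho m * n =
    c * (rho m * rho n * l).
  by rewrite !mulf_neq0 // rho_neq0.
(* Only the bare [n] is rewritten, not the one inside [rho n]. *)
case: (height_rhoP m) => ->; case: (heightP l) => ->; case: rn => {2}->.
- by exists 1; [exact: oner_neq0 | ring].
- by exists (2%:R * e + 1) => //; ring.
- by exists (5%:R * e + 1) => //; ring.
- by exists (- (3%:R * e - 1)); [rewrite oppr_eq0 | ring].
- by exists (3%:R * e + 4%:R) => //; ring.
- by exists (5%:R * e + 4%:R) => //; ring.
- exists (4%:R * (2%:R * e + 1)); [exact: mulf_neq0 | ring].
- by exists 4%:R => //; ring.
Qed.

Lemma line_free_set_blocks_alongZ (x y u v : F) :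
  exists s, (x + s * u, y + s * v, s) \notin line_free_set.
Proof.
have [/line_free_set_floor [x0 ->] | ] :=
    boolP ((x, y, 0) \in line_free_set); last first.
  by exists 0; rewrite !mul0r !addr0.
have h0 := height_neq0 x0.
have [-> | u0] := eqVneq u 0; have [-> | v0] := eqVneq v 0.
- by exists (rho x); rewrite !mulr0 !addr0 notin_line_free_set_lostY.
- have s0 : - height x / v != 0 by rewrite mulf_neq0 ?invr_eq0 ?oppr_eq0.
  have [/(line_free_set_sideY s0) [_ es] | ] :=
      boolP ((x, 0, - height x / v) \in line_free_set); last first.
    by exists (- height x / v); rewrite mulr0 addr0 divfK // addrN.
  (* The line joins the floor point to [(x, 0, rho x)]; at parameter [- e * rho x] its second
     coordinate is multiplied by [1 + e], which gives a point of [lostX]. *)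
  exists (- e * rho x); rewrite mulr0 addr0.
  suff -> : height x + - e * rho x * v = (1 + e) * height x.
    exact: notin_line_free_set_lostX.
  by rewrite -es; field.
(* The constant second coordinate [height x] is a residue, unlike that of any point of
   [new_sideX]. *)
- exists (- x / u); rewrite divfK // addrN mulr0 addr0.
  have s0 : - x / u != 0 by rewrite mulf_neq0 ?invr_eq0 ?oppr_eq0.
  apply/negP => /(line_free_set_sideX s0) [l l0 [eh _]].
  by have := qres_sideX_height l0; rewrite -eh qres_height.
have s0 : - x / u != 0 by rewrite mulf_neq0 ?invr_eq0 ?oppr_eq0.
have s'0 : - height x / v != 0 by rewrite mulf_neq0 ?invr_eq0 ?oppr_eq0.
(* If the points on [x = 0] and [y = 0] were both in the set, eliminating [u] and [v] would give the
   equality excluded by [height_ratio_neq]. *)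
have [ | ] := boolP ((0, height x + - x / u * v, - x / u) \in line_free_set);
  last first.
  by exists (- x / u); rewrite divfK // addrN.
case/(line_free_set_sideX s0) => m m0 [eh em].
have [ | ] := boolP ((x + - height x / v * u, 0, - height x / v)
                       \in line_free_set); last first.
  by exists (- height x / v); rewrite divfK // addrN.
case/(line_free_set_sideY s'0); set n := x + _ => n0 en.
have /eqP[] := height_ratio_neq x0 m0 n0.
rewrite -eh -en /n.
have -> : e * height x * rho m = - height x * (- e * rho m) by ring.
by rewrite -em; field; rewrite v0.
Qed.

Lemma line_free_set_blocks_lines (x y z u v w : F) : (u, v, w) != (0, 0, 0) ->
  exists s, (x + s * u, y + s * v, z + s * w) \notin line_free_set.
Proof.
apply: (blocks_linesP (B := fun x y z => (x, y, z) \notin line_free_set)).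
- exact: line_free_set_blocks_alongZ.
- exact: line_free_set_blocks_alongY.
exact: line_free_set_blocks_alongX.
Qed.

End Construction.

(** * From blocked lines to a lower bound for [r] *)

Section Transfer.
Local Open Scope ring_scope.

(** Each scalar of ['F_p] comes from a natural number below [p], so a progression of length [p] is a
    full line. *)
Lemma leq_r_line_free (p n : nat) (A : {set 'rV['F_p]_n}) :
  prime p -> (forall a b, b != 0 -> exists c, a + c *: b \notin A) ->
  (#|A| <= r p p n)%N.
Proof.
move=> p_pr blockA; apply: (@leq_bigmax_cond _ _ (fun B : {set _} => #|B|)).
apply/forallP => S; apply/implyP => /existsP [a /existsP [b /andP [b0 /eqP ->]]].
have [c] := blockA a b b0; apply: contra => /subsetP; apply.
have c_lt : (c < p)%N by have := ltn_ord c; rewrite [X in (_ < X)%N](Fp_cast p_pr).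
by apply/imsetP; exists (Ordinal c_lt); rewrite //= natr_Zp.
Qed.

Definition coords (K : Type) (w : 'rV[K]_3) : K * K * K :=
  (w 0 0, w 0 1, w 0 (inord 2)).

Lemma leq_r_line_free3 (p : nat) (A : {set 'F_p * 'F_p * 'F_p}) :
  prime p ->
  (forall x y z u v w, (u, v, w) != (0, 0, 0) ->
     exists s, (x + s * u, y + s * v, z + s * w) \notin A) ->
  (#|A| <= r p p 3)%N.
Proof.
move=> p_pr blockA; pose A' := [set w | coords w \in A].
have coords_row (t : 'F_p * 'F_p * 'F_p) :
    coords (\row_(i < 3) nth 0 [:: t.1.1; t.1.2; t.2] i) = t.
  by case: t => -[x y] z; rewrite /coords !mxE /= inordK.
(* [coords] has an explicit right inverse, so [A] is contained in the image of [A']. *)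
apply: (@leq_trans #|A'|).
  apply: leq_trans (leq_imset_card (@coords _) A'); apply/subset_leq_card/subsetP.
  move=> t At; apply/imsetP; exists (\row_(i < 3) nth 0 [:: t.1.1; t.1.2; t.2] i).
    by rewrite inE coords_row.
  by rewrite coords_row.
apply: leq_r_line_free => // a b b0.
have /blockA : coords b != (0, 0, 0).
  apply: contra b0 => /eqP [b_0 b_1 b_2].
  apply/eqP/rowP => i; rewrite mxE; case: i => -[|[|[|//]]] lt_i.
  - by rewrite -[RHS]b_0; congr (b 0 _); apply: val_inj.
  - by rewrite -[RHS]b_1; congr (b 0 _); apply: val_inj.
  by rewrite -[RHS]b_2; congr (b 0 _); apply: val_inj; rewrite /= inordK.
by move=> /(_ (a 0 0) (a 0 1) (a 0 (inord 2))) [s As]; exists s;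
  rewrite inE /coords !mxE.
Qed.

End Transfer.

(* Representatives, up to permuting the coordinates, of a set of [118] points
   meeting all lines of [F_7^3]; found by a computer search. *)
Definition blocking7 : seq (seq nat) :=
  [:: [:: 0; 0; 0]; [:: 0; 0; 1]; [:: 0; 0; 2]; [:: 0; 0; 4]; [:: 0; 0; 5];
      [:: 0; 0; 6]; [:: 0; 1; 1]; [:: 0; 1; 2]; [:: 0; 2; 2]; [:: 0; 3; 3];
      [:: 1; 1; 1]; [:: 1; 1; 4]; [:: 1; 2; 2]; [:: 1; 3; 3]; [:: 1; 4; 4];
      [:: 1; 4; 6]; [:: 1; 5; 5]; [:: 2; 2; 2]; [:: 2; 2; 4]; [:: 2; 2; 5];
      [:: 2; 3; 3]; [:: 2; 3; 5]; [:: 2; 3; 6]; [:: 2; 4; 4]; [:: 2; 5; 5];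
      [:: 2; 6; 6]; [:: 3; 3; 3]; [:: 3; 3; 5]; [:: 3; 3; 6]; [:: 3; 4; 4];
      [:: 3; 5; 5]; [:: 3; 5; 6]; [:: 3; 6; 6]; [:: 4; 4; 4]; [:: 4; 5; 5];
      [:: 5; 5; 5]; [:: 5; 5; 6]; [:: 5; 6; 6]; [:: 6; 6; 6]].

Definition blocked7 (x y z : nat) : bool :=
  sort leq [:: x %% 7; y %% 7; z %% 7] \in blocking7.

(** The conjuncts are the three hypotheses of [blocks_linesP], stated on natural numbers to be
    decided by evaluation. *)
Lemma blocked7_lines :
  let I := iota 0 7 in
  [&& all (fun x => all (fun y => all (fun u => all (fun v =>
        has (fun s => blocked7 (x + s * u) (y + s * v) s) I) I) I) I) I,
      all (fun x => all (fun z => all (fun u =>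
        has (fun s => blocked7 (x + s * u) s z) I) I) I) I &
      all (fun y => all (fun z => has (fun s => blocked7 s y z) I) I) I].
Proof. by vm_compute. Qed.

Lemma card_blocked7 :
  sumn [seq sumn [seq sumn [seq nat_of_bool (~~ blocked7 x y z)
    | z <- index_iota 0 7] | y <- index_iota 0 7] | x <- index_iota 0 7]
  = 225.
Proof. by vm_compute. Qed.

Lemma leq_225_r : 225 <= r 7 7 3.
Proof.
pose A := [set t : 'F_7 * 'F_7 * 'F_7 | ~~ blocked7 t.1.1 t.1.2 t.2].
have <- : #|A| = 225.
  rewrite -sum1_card big_mkcond /=.
  transitivity (\sum_(t : 'F_7 * 'F_7 * 'F_7)
      nat_of_bool (~~ blocked7 t.1.1 t.1.2 t.2)).
    by apply: eq_bigr => t _; rewrite inE; case: blocked7.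
  rewrite -(pair_bigA _ (fun (t : 'F_7 * 'F_7) (z : 'F_7) =>
    nat_of_bool (~~ blocked7 t.1 t.2 z))) /=.
  rewrite -(pair_bigA _ (fun x y : 'F_7 => \sum_(z : 'F_7)
    nat_of_bool (~~ blocked7 x y z))) /=.
  rewrite -card_blocked7 sumnE big_map big_mkord; apply: eq_bigr => x _.
  rewrite sumnE big_map big_mkord; apply: eq_bigr => y _.
  by rewrite sumnE big_map big_mkord.
apply: leq_r_line_free3 => //.
have memI (x : 'F_7) : val x \in iota 0 7 by rewrite mem_iota ltn_ord.
have /and3P [/allP blockZ /allP blockY /allP blockX] := blocked7_lines.
apply: (blocks_linesP (B := fun x y z => (x, y, z) \notin A)).
- move=> x y u v; have := blockZ _ (memI x).
  move=> /allP/(_ _ (memI y))/allP/(_ _ (memI u))/allP/(_ _ (memI v))/hasP [s].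
  rewrite mem_iota => s7 bs; exists (Ordinal s7 : 'F_7).
  (* The modulus hidden in ['F_7] is turned into the literal 7, so that the reductions in [blocked7]
     absorb those of the field operations. *)
  by rewrite inE negbK /= -[(Zp_trunc _).+2]/(7) /blocked7 !modn_mod !modnDmr.
- move=> x z u; have := blockY _ (memI x).
  move=> /allP/(_ _ (memI z))/allP/(_ _ (memI u))/hasP [s].
  rewrite mem_iota => s7 bs; exists (Ordinal s7 : 'F_7).
  by rewrite inE negbK /= -[(Zp_trunc _).+2]/(7) /blocked7 !modn_mod !modnDmr.
move=> y z; have := blockX _ (memI y); move=> /allP/(_ _ (memI z))/hasP [s].
rewrite mem_iota => s7 bs; exists (Ordinal s7 : 'F_7).
by rewrite inE negbK.
Qed.

(** * Choice of [e] for primes congruent to 7 modulo 24 *)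

Section PrimeField.
Variable p : nat.
Hypotheses (p_pr : prime p) (p_mod : p = 7 %[mod 24]) (p_neq7 : p != 7).
Local Open Scope ring_scope.

Lemma natr_Fp_neq0 n : (0 < n < p)%N -> n%:R != 0 :> 'F_p.
Proof.
by case/andP=> n0 np; rewrite -(dvdn_pcharf (pchar_Fp p_pr)) gtnNdvd.
Qed.

Lemma exists_qres_succ : exists2 e : 'F_p,
  [/\ e != 0, qres e, 1 + e != 0 & ~~ qres (1 + e)] &
  [/\ 2%:R * e + 1 != 0, 3%:R * e - 1 != 0, 5%:R * e + 1 != 0,
      3%:R * e + 4%:R != 0 & 5%:R * e + 4%:R != 0].
Proof.
have p_ge : (31 <= p)%N by move: p_mod p_neq7; lia.
have nz n : (0 < n < 31)%N -> n%:R != 0 :> 'F_p.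
  by move=> n_lt; apply: natr_Fp_neq0; lia.
have oddF : odd #|'F_p| by rewrite card_Fp //; move: p_mod; lia.
(* -3 is a residue as 3 divides [p - 1], and -1 is not, as [(p - 1) / 2] is odd. *)
have nqres3 : ~~ qres (3%:R : 'F_p).
  rewrite -[3%:R]opprK qresN ?oppr_eq0 ?nz // ?negbK.
    by apply: qresN3; rewrite ?nz // card_Fp //; move: p_mod; lia.
  by apply: qresN1 => //; rewrite card_Fp //; move: p_mod; lia.
(* Either 2 is a residue followed by the non-residue 3, or 1 is a residue followed by the
   non-residue 2. *)
have [q2 | nq2] := boolP (qres (2%:R : 'F_p)).
  exists 2%:R; split.
  - exact: nz.
  - by [].
  - by rewrite nat1r nz.
  - by rewrite nat1r.
  - by rewrite (_ : _ + _ = 5%:R) ?nz //; ring.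
  - by rewrite (_ : _ - _ = 5%:R) ?nz //; ring.
  - by rewrite (_ : _ + _ = 11%:R) ?nz //; ring.
  - by rewrite (_ : _ + _ = 10%:R) ?nz //; ring.
  (* This value vanishes modulo 7, so [e = 2] would fail for [p = 7]. *)
  by rewrite (_ : _ + _ = 14%:R) ?nz //; ring.
exists 1; split.
- exact: oner_neq0.
- exact: qres1.
- exact: (nz 2).
- by [].
- by rewrite (_ : _ + _ = 3%:R) ?nz //; ring.
- by rewrite (_ : _ - _ = 2%:R) ?nz //; ring.
- by rewrite (_ : _ + _ = 6%:R) ?nz //; ring.
- by rewrite (_ : _ + _ = 7%:R) ?nz //; ring.
by rewrite (_ : _ + _ = 9%:R) ?nz //; ring.
Qed.

Lemma leq_r_7mod24 : ((p - 1) ^ 3 + (p - 1) <= r p p 3)%N.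
Proof.
have [e [e0 qe e1 qe1] e_gen] := exists_qres_succ.
have oddF : odd #|'F_p| by rewrite card_Fp //; move: p_mod; lia.
have qresFN1 : ~~ qres (-1 : 'F_p).
  by apply: qresN1 => //; rewrite card_Fp //; move: p_mod; lia.
apply: (@leq_trans #|line_free_set e|).
  have := card_line_free_set oddF qresFN1 e0 qe e1 qe1.
  rewrite card_Fp // subn1; apply; apply: natr_Fp_neq0.
  by move: p_mod p_neq7; lia.
apply: leq_r_line_free3 => // x y z u v w.
exact: line_free_set_blocks_lines.
Qed.

End PrimeField.

Theorem theorem1p2 :
  (forall p : nat, prime p -> p = 7 %[mod 24] ->
     (p - 1) ^ 3 + (p - 1) <= r p p 3 /\
     (p - 1) ^ 3 + (p - 1) = p ^ 3 - 3 * p ^ 2 + 4 * p - 2) /\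
  225 <= r 7 7 3.
Proof.
split=> [p p_pr p_mod|]; last exact: leq_225_r.
(* The congruence gives [p >= 7], so the subtractions on naturals are not truncated. *)
split; last by rewrite !expnS expn0; move: p_mod; nia.
(* For [p = 7] the bound is 222, below 225. *)
have [-> | p_neq7] := eqVneq p 7; last exact: leq_r_7mod24.
exact: leq_trans leq_225_r.
Qed.
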